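(* Let $\mathcal A\in\mathbb C^{\mathbf I\times\mathbf I}$, $\mathcal B\in\mathbb C^{\mathbf H\times\mathbf I}$, $\mathcal C\in\mathbb C^{\mathbf I\times\mathbf H}$, $\mathcal D\in\mathbb C^{\mathbf H\times\mathbf H}$ be complex tensors. Put $\mathcal A^\pi=\mathcal I-\mathcal A\mathcal A^D$, $\mathcal Y=\mathcal C\mathcal D^D\mathcal B$, $\mathcal S=\mathcal A-\mathcal C\mathcal D^D\mathcal B$, $\mathcal Z=\mathcal D-\mathcal B\mathcal A^D\mathcal C$, $\mathcal D^\pi=\mathcal I-\mathcal D\mathcal D^D$, $\mathcal Z^\pi=\mathcal I-\mathcal Z\mathcal Z^D$, $\mathcal H=\mathcal B\mathcal A^D$, $\mathcal K=\mathcal A^D\mathcal C$ and $\mathcal T=\mathcal A^D+\mathcal K\mathcal Z^D\mathcal H$. Assume that $\mathcal K\mathcal D^\pi\mathcal Z^D\mathcal H=\mathcal K\mathcal D^D\mathcal Z^\pi\mathcal H$ and let $k=\mathrm{ind}(\mathcal A)$. (a) If $\mathcal S\mathcal A^\pi\mathcal Y=0$, then $$\mathcal S^D=-\sum_{i=0}^{k-1}(\mathcal I-\mathcal A^\pi\mathcal Y\mathcal T)\,\mathcal T^{i+2}\mathcal Y\mathcal A^\pi\mathcal A^i+\mathcal T-\mathcal A^\pi\mathcal Y\mathcal T^2 .$$ (b) If $\mathcal Y\mathcal A^\pi\mathcal S=0$, then $$\mathcal S^D=-\sum_{i=0}^{k-1}\mathcal A^i\mathcal A^\pi\mathcal Y\mathcal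 T^{i+2}(\mathcal I-\mathcal T\mathcal Y\mathcal A^\pi)+\mathcal T-\mathcal T^2\mathcal Y\mathcal A^\pi .$$
   Context: Fix positive integers $N,M,I_1,\dots,I_N,H_1,\dots,H_M$; write $\mathbf I=I_1\times\cdots\times I_N$ and $\mathbf H=H_1\times\cdots\times H_M$, and let $\mathbb C^{\mathbf J\times\mathbf L}$ ($\mathbf J,\mathbf L\in\{\mathbf I,\mathbf H\}$) denote the complex tensors with row multi-index in $\mathbf J$ and column multi-index in $\mathbf L$. Juxtaposition denotes the Einstein product (written $*_N$ in the paper): $(\mathcal P\mathcal Q)_{\mathbf j\mathbf l}=\sum_{\mathbf h}\mathcal P_{\mathbf j\mathbf h}\mathcal Q_{\mathbf h\mathbf l}$, the sum running over all values of the shared multi-index $\mathbf h$; it is associative. A tensor in $\mathbb C^{\mathbf J\times\mathbf J}$ is called square; $\mathcal I$ is the unit tensor of the appropriate size (diagonal entries $1$, all others $0$) and $\mathcal P^0=\mathcal I$. The index $\mathrm{ind}(\mathcal P)$ of a square tensor is the smallest integer $l\ge 0$ such that $\mathcal P^l$ and $\mathcal P^{l+1}$ have the same range, where the range of $\mathcal P$ is $\{\mathcal P\mathcal X\}$. The Drazin inverse $\mathcal P^D$ is the (unique, always existing) square tensor $\mathcal X$ with $\mathcal P^l\mathcal X\mathcal P=\mathcal P^l$, $\mathcal X\mathcal P\mathcal X=\mathcal X$, $\mathcal P\mathcal X=\mathcal X\mathcal P$, where $l\ge\mathrm{ind}(\mathcal P)$. A sum whose lower limit exceeds its upper limit is $0$.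 *)

(* Defs.v *)
From HB Require Import structures.
From mathcomp Require Import all_boot all_order all_algebra.
From mathcomp Require Import boolp reals complex.

Set Implicit Arguments.
Unset Strict Implicit.
Unset Printing Implicit Defensive.

Import GRing.Theory.
Local Open Scope ring_scope.

(* Multi-indices (j_1, ..., j_N) with j_k ranging over d_k values. *)
Definition midx (N : nat) (d : 'I_N -> nat) : finType :=
  {dffun forall k : 'I_N, 'I_(d k)}.

(* Own alias, with only the additive structure: the canonical ring structure *)
(* of {ffun _ -> _} is the entrywise one, not the Einstein product.          *)
Definition tensor (F : fieldType) (J L : finType) : Type := {ffun J * L -> F}.

HB.instance Definition _ (F : fieldType) (J L : finType) :=
  GRing.Zmodule.copy (tensor F J L) {ffun J * L -> F}.

Section Tensors.
Variable F : fieldType.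

Definition einprod (J K L : finType) (P : tensor F J K) (Q : tensor F K L) :
    tensor F J L :=
  [ffun p => \sum_(h : K) P (p.1, h) * Q (h, p.2)].

Definition tunit (J : finType) : tensor F J J := [ffun p => (p.1 == p.2)%:R].

Definition tpow (J : finType) (P : tensor F J J) (l : nat) : tensor F J J :=
  iter l (einprod P) (tunit J).

(* Einstein product of a tensor with a tensor having no column indices. *)
Definition einapp (J K : finType) (P : tensor F J K) (x : {ffun K -> F}) :
    {ffun J -> F} :=
  [ffun j => \sum_(h : K) P (j, h) * x h].

Definition in_range (J K : finType) (P : tensor F J K) (y : {ffun J -> F}) :
    Prop :=
  exists x : {ffun K -> F}, y = einapp P x.

Definition same_range (J K L : finType) (P : tensor F J K) (Q : tensor F J L) :
    Prop :=
  forall y : {ffun J -> F}, in_range P y <-> in_range Q y.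

End Tensors.

Arguments tunit {F} J.
Arguments tpow {F J} P l%_N.

Notation "P ** Q" := (einprod P Q)
  (at level 40, left associativity) : ring_scope.
Notation "P ^^ l" := (tpow P l)
  (at level 30, right associativity) : ring_scope.

Section EinsteinProduct.
Variable F : fieldType.
Implicit Types J K L M : finType.

Lemma einprodA J K L M (P : tensor F J K) (Q : tensor F K L)
    (R : tensor F L M) : P ** (Q ** R) = P ** Q ** R.
Proof.
apply/ffunP => p; rewrite !ffunE /=.
under eq_bigr => h _ do rewrite ffunE /= mulr_sumr.
rewrite exchange_big /=; apply: eq_bigr => l _.
by rewrite ffunE /= mulr_suml; apply: eq_bigr => h _; rewrite mulrA.
Qed.

Lemma einprod1l J L (P : tensor F J L) : tunit J ** P = P.
Proof.
apply/ffunP => -[j l]; rewrite ffunE /= (bigD1 j) //= ffunE /= eqxx mul1r.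
rewrite big1 ?addr0 // => h /negPf hj.
by rewrite ffunE /= eq_sym hj mul0r.
Qed.

Lemma einprod1r J L (P : tensor F J L) : P ** tunit L = P.
Proof.
apply/ffunP => -[j l]; rewrite ffunE /= (bigD1 l) //= ffunE /= eqxx mulr1.
by rewrite big1 ?addr0 // => h /negPf hl; rewrite ffunE /= hl mulr0.
Qed.

Lemma einprodDr J K L (P : tensor F J K) (Q R : tensor F K L) :
  P ** (Q + R) = P ** Q + P ** R.
Proof.
apply/ffunP => p; rewrite !ffunE -big_split /=.
by apply: eq_bigr => h _; rewrite ffunE mulrDr.
Qed.

Lemma einprodDl J K L (P Q : tensor F J K) (R : tensor F K L) :
  (P + Q) ** R = P ** R + Q ** R.
Proof.
apply/ffunP => p; rewrite !ffunE -big_split /=.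
by apply: eq_bigr => h _; rewrite ffunE mulrDl.
Qed.

Lemma einprod0r J K L (P : tensor F J K) : P ** (0 : tensor F K L) = 0.
Proof.
by apply/ffunP => p; rewrite !ffunE big1 // => h _; rewrite ffunE mulr0.
Qed.

Lemma einprod0l J K L (P : tensor F K L) : (0 : tensor F J K) ** P = 0.
Proof.
by apply/ffunP => p; rewrite !ffunE big1 // => h _; rewrite ffunE mul0r.
Qed.

Lemma einapp_einprod J K L (P : tensor F J K) (Q : tensor F K L) x :
  einapp P (einapp Q x) = einapp (P ** Q) x.
Proof.
apply/ffunP => j; rewrite !ffunE /=.
under eq_bigr => h _ do rewrite ffunE /= mulr_sumr.
rewrite exchange_big /=; apply: eq_bigr => l _.
by rewrite ffunE /= mulr_suml; apply: eq_bigr => h _; rewrite mulrA.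
Qed.

Lemma tpowS J (P : tensor F J J) l : P ^^ l.+1 = P ** P ^^ l.
Proof. by []. Qed.

Lemma tpowD J (P : tensor F J J) l m : P ^^ (l + m) = P ^^ l ** P ^^ m.
Proof.
elim: l => [|l IHl]; first by rewrite einprod1l.
by rewrite addSn !tpowS IHl einprodA.
Qed.

Lemma tpowSr J (P : tensor F J J) l : P ^^ l.+1 = P ^^ l ** P.
Proof. by rewrite -addn1 tpowD tpowS einprod1r. Qed.

Lemma tpow_comm J (P Q : tensor F J J) l :
  P ** Q = Q ** P -> P ^^ l ** Q = Q ** P ^^ l.
Proof.
move=> PQ; elim: l => [|l IHl]; first by rewrite einprod1l einprod1r.
by rewrite tpowS -einprodA IHl !einprodA PQ.
Qed.

(* Finite dimension: the powers of P are linearly dependent. *)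
Lemma tpow_dep J (P : tensor F J J) :
  exists (d : nat) (c : 'I_d -> F), (exists i, c i != 0) /\
    forall p, \sum_(i < d) c i * (P ^^ i) p = 0.
Proof.
pose d := #|{: J * J}|.
pose A : 'M[F]_(d.+1, d) := \matrix_(i, j) (P ^^ i) (enum_val j).
have : kermx A != 0.
  by rewrite kermx_eq0 /row_free neq_ltn ltnS rank_leq_col.
case/rowV0Pn => v /sub_kermxP vA v0.
exists d.+1, (v 0); split.
  apply/existsP; apply: contraNT v0; rewrite negb_exists => /forallP v0.
  by apply/eqP/rowP => i; rewrite mxE; apply/eqP; rewrite -[_ == _]negbK v0.
move=> p; have /rowP/(_ (enum_rank p)) := vA.
rewrite !mxE => vA0; rewrite -[RHS]vA0; apply: eq_bigr => i _.
by rewrite mxE enum_rankK.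
Qed.

Lemma tpow_stab J (P : tensor F J J) :
  exists (l : nat) (X : tensor F J J),
    P ** X = X ** P /\ P ^^ l = P ^^ l.+1 ** X.
Proof.
have [d [c [[i0 ci0] cP]]] := tpow_dep P.
case: (@arg_minnP _ i0 (fun i => c i != 0) (fun i => val i) ci0) => i ci i_min.
pose sc (a : F) : tensor F J J := [ffun p => a * (p.1 == p.2)%:R].
have scE a (Q : tensor F J J) p : (sc a ** Q) p = a * Q p.
  case: p => j l; rewrite ffunE /= (bigD1 j) //= ffunE /= eqxx mulr1.
  rewrite big1 ?addr0 // => h /negPf hj.
  by rewrite ffunE /= eq_sym hj mulr0 mul0r.
have scC a (Q : tensor F J J) : Q ** sc a = sc a ** Q.
  apply/ffunP => -[j l]; rewrite scE ffunE /= (bigD1 l) //= ffunE /= eqxx mulr1.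
  rewrite big1 ?addr0 1?mulrC // => h /negPf hl.
  by rewrite ffunE /= hl !mulr0.
pose X : tensor F J J :=
  \sum_(j < d | (i < j)%N) sc (- c j / c i) ** P ^^ (j - i.+1).
have sumr (Q : tensor F J J) (G : 'I_d -> tensor F J J) :
    Q ** (\sum_(j < d | (i < j)%N) G j) = \sum_(j < d | (i < j)%N) Q ** G j.
  exact: (big_morph _ (einprodDr Q) (einprod0r J Q)).
have suml (Q : tensor F J J) (G : 'I_d -> tensor F J J) :
    (\sum_(j < d | (i < j)%N) G j) ** Q = \sum_(j < d | (i < j)%N) G j ** Q.
  by apply: (big_morph (fun R => R ** Q)) => [R S|];
    rewrite ?einprodDl ?einprod0l.
exists (val i), X; split.
  rewrite sumr suml; apply: eq_bigr => j _.
  by rewrite einprodA scC -!einprodA -tpowS -tpowSr.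
rewrite sumr; apply/ffunP => p; rewrite sum_ffunE.
under eq_bigr => j ij do
  rewrite einprodA scC -einprodA -tpowD subnKC // scE mulrAC.
rewrite -mulr_suml; apply: (mulIf ci); rewrite mulfVK // mulrC.
have := cP p; rewrite (bigID (fun j : 'I_d => (i < j)%N)) /=.
rewrite [X in _ + X](bigD1 i) ?ltnn //= [X in _ + (_ + X)]big1 => [|j].
  rewrite addr0 addrC => /eqP; rewrite addr_eq0 => /eqP ->.
  by rewrite -sumrN; apply: eq_bigr => j _; rewrite mulNr.
rewrite -leqNgt => /andP[ji]; have [-> _|cj] := eqVneq (c j) 0.
  by rewrite mul0r.
by rewrite -val_eqE /= eqn_leq ji i_min.
Qed.

Lemma ind_ex J (P : tensor F J J) :
  exists l, `[< same_range (P ^^ l) (P ^^ l.+1) >].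
Proof.
have [l [X [_ Pl]]] := tpow_stab P; exists l; apply/asboolP => y.
split=> -[x ->]; last by exists (einapp P x); rewrite einapp_einprod tpowSr.
by exists (einapp X x); rewrite einapp_einprod -Pl.
Qed.

(* The smallest l with range (P ^^ l) = range (P ^^ l.+1). *)
Definition ind J (P : tensor F J J) : nat := ex_minn (ind_ex P).

Definition is_drazin J (P X : tensor F J J) : Prop :=
  exists l : nat, [/\ (ind P <= l)%N,
    P ^^ l ** X ** P = P ^^ l,
    X ** P ** X = X &
    P ** X = X ** P].

Lemma drazin_ex J (P : tensor F J J) : exists X, is_drazin P X.
Proof.
have [l [Y [PY Pl]]] := tpow_stab P.
have PlD m : P ^^ l = P ^^ (l + m) ** Y ^^ m.
  elim: m => [|m IHm]; first by rewrite addn0 einprod1r.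
  rewrite {1}IHm addnC tpowD Pl einprodA -tpowD.
  by rewrite -einprodA -tpowS addnC addSnnS.
have comm m : P ** Y ^^ m = Y ^^ m ** P by rewrite (tpow_comm _ (esym PY)).
pose X := P ^^ l ** Y ^^ l.+1.
have PX : P ** X = X ** P.
  by rewrite /X -[RHS]einprodA -comm !einprodA -tpowS tpowSr.
have PXE : P ** X = P ^^ l ** Y ^^ l.
  by rewrite /X einprodA -tpowS tpowS einprodA -Pl.
have stab m : (l <= m)%N -> P ** X ** P ^^ m = P ^^ m.
  move=> /subnKC <-; rewrite tpowD einprodA; congr (_ ** _).
  rewrite PXE -einprodA -(tpow_comm l (comm l)) einprodA -tpowD.
  by rewrite -PlD.
exists X, (maxn l (ind P)); split=> //; first exact: leq_maxr.
  rewrite -einprodA -PX (tpow_comm _ (_ : P ** (P ** X) = P ** X ** P)).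
    by rewrite stab ?leq_maxl.
  by rewrite -einprodA -PX.
by rewrite -PX /X einprodA stab.
Qed.

Definition drazin J (P : tensor F J J) : tensor F J J :=
  projT1 (cid (drazin_ex P)).

Lemma drazinP J (P : tensor F J J) : is_drazin P (drazin P).
Proof. exact: projT2 (cid (drazin_ex P)). Qed.

Lemma drazin_unique J (P X Y : tensor F J J) :
  is_drazin P X -> is_drazin P Y -> X = Y.
Proof.
have powl (Z : tensor F J J) m : Z ** P ** Z = Z -> P ** Z = Z ** P ->
    Z = Z ^^ m.+1 ** P ^^ m.
  move=> ZPZ PZ; elim: m => [|m IHm]; first by rewrite tpowS !einprod1r.
  rewrite (tpowS Z m.+1) (tpowSr P m) einprodA -(einprodA Z _ (P ^^ m)) -IHm.
  by rewrite -einprodA -PZ einprodA ZPZ.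
have powr (Z : tensor F J J) m : Z ** P ** Z = Z -> P ** Z = Z ** P ->
    Z = P ^^ m ** Z ^^ m.+1.
  move=> ZPZ PZ; rewrite {1}(powl Z m) //.
  by rewrite (tpow_comm _ (esym (tpow_comm _ PZ))).
have mono (Z : tensor F J J) l m : (l <= m)%N ->
    P ^^ l ** Z ** P = P ^^ l -> P ^^ m ** Z ** P = P ^^ m.
  by move=> /subnK <- PZ; rewrite tpowD -!einprodA (einprodA _ Z) PZ.
move=> [l [_ lX XPX PX]] [m [_ mY YPY PY]]; pose n := maxn l m.
have nX := mono _ _ _ (leq_maxl l m : (l <= n)%N) lX.
have nY := mono _ _ _ (leq_maxr l m : (m <= n)%N) mY.
have -> : X = X ** (Y ** P).
  by rewrite {1}(powl X n) // -nY -einprodA einprodA -powl.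
have nX' : X ** P ** P ^^ n = P ^^ n.
  rewrite -(tpow_comm n (_ : P ** (X ** P) = X ** P ** P)) ?einprodA ?PX //.
by rewrite -PY [RHS](powr Y n) // -nX' -!einprodA -powr.
Qed.

End EinsteinProduct.

(* Main.v *)
Require Import Defs.
From HB Require Import structures.
From mathcomp Require Import all_boot all_order all_algebra.
From mathcomp Require Import boolp reals complex.

(** Write e = A A^D and p = A^pi = 1 - e, an idempotent commuting with A.
The tensor T satisfies e T = T = T e, and expanding e S T with
B A^D C = D - Z leaves e plus a defect that the hypothesis on K and H kills:
multiplied by A on the left, that hypothesis is exactly the vanishing of the
defect ([schur_corner_right_inverse]).  So T is a right inverse of e S e in the
corner e _ e; the tensor algebra is finite dimensional, so T is a left inverse
as well ([einprod_mul1C]).  From then on only S = A - Y, p and T matter,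
and everything happens in a ring where p A^k = 0, k being the index of A.

Put v = sum_(i < k) T^(i+1) Y p A^i and g = 1 - p Y T.  The candidate of
part (a) is X = g T (1 - v).  When S p Y = 0, one has S g = S, S T = g e,
T S = e - T Y p and v S = v A.  With u = e - v, the first two give S X = g u.
The last two and the telescoping identity T Y p + T v A = v give
T (1 - v) S = u, hence X S = g u as well.  Thus X commutes with S, and
X S X = X follows from v T = 0 and u g = u.  Finally S (1 - X S) = S (p + v),
and S (p + v) S^m = S (p + v) A^m for all m, which is 0 for m = k; so
S^(k+1) X S = S^(k+1), and X is the Drazin inverse
([corner_drazin_inverse]).

All the hypotheses on A, Y, p and T used here are left-right symmetric, except
S p Y = 0, which becomes Y p S = 0.  Hence part (b) is part (a) in the
opposite ring. *)

Import GRing.Theory.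
Local Open Scope ring_scope.

Set Implicit Arguments.
Unset Strict Implicit.

(** * Drazin inverses in a ring *)

(** The exponent l is not tied to an index here: in a ring without a range
notion, an identity that holds for one exponent holds for all larger ones. *)
Definition drazin_inverse {R : pzRingType} (s x : R) : Prop :=
  exists l, [/\ s ^+ l * x * s = s ^+ l, x * s * x = x & s * x = x * s].

(** The block picture behind the formula: with respect to 1 = (1 - p) + p the
element s has an invertible block (1 - p) s (1 - p) with inverse t, while the
p-part of a is nilpotent.  Then s p y = 0 makes the correction terms
coming from y p a^i a finite geometric-type sum. *)
Lemma corner_drazin_inverse (R : pzRingType) (a y p t : R) (k : nat) :
  let s := a - y in
  p * p = p -> a * p = p * a -> p * a ^+ k = 0 ->
  p * t = 0 -> t * p = 0 ->
  (1 - p) * s * t = 1 - p -> t * s * (1 - p) = 1 - p ->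
  s * p * y = 0 ->
  drazin_inverse s
    (- (\sum_(i < k) (1 - p * y * t) * t ^+ i.+2 * y * p * a ^+ i)
     + t - p * y * t ^+ 2).
Proof.
move=> s pp ap pak pt tp est tse spy.
have zs z : z * s = z * a - z * y by rewrite mulrBr.
have sz z : s * z = a * z - y * z by rewrite mulrBl.
(* From here on s is opaque, since rewriting rules for sums would otherwise see
   through it. *)
clearbody s; set e := 1 - p in est tse.
have et : e * t = t by rewrite mulrBl mul1r pt subr0.
have te : t * e = t by rewrite mulrBr mulr1 tp subr0.
have apX i : a ^+ i * p = p * a ^+ i.
  by apply/esym/commrX; rewrite /GRing.comm ap.
have ypy : y * p * y = p * a * y.
  by rewrite -ap; apply/esym/subr0_eq; rewrite -mulrBl -sz.
(* Since p a y = y p y, each power of a between p and y can be traded for a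
   factor y p, until z meets p y. *)
have zpay z i : z * p * y = 0 -> z * p * a ^+ i * y = 0.
  move=> zpy; elim: i => [|i IHi]; first by rewrite mulr1.
  have pa : p * a ^+ i.+1 = p * a ^+ i * (p * a).
    by rewrite -{1}pp exprSr -!mulrA [p * (_ * a)]mulrA -apX !mulrA.
  rewrite -[z * p * _]mulrA pa -!mulrA [p * (a * _)]mulrA -ypy !mulrA.
  by rewrite IHi !mul0r.
have typay i : t * y * p * a ^+ i * y = 0.
  by apply: zpay; rewrite -!mulrA [y * _]mulrA ypy !mulrA tp !mul0r.
pose v := \sum_(i < k) t ^+ i.+1 * y * p * a ^+ i.
pose g := 1 - p * y * t.
have ev : e * v = v.
  by rewrite mulr_sumr; apply: eq_bigr => i _; rewrite exprS !mulrA et.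
have vt : v * t = 0.
  rewrite mulr_suml big1 // => i _.
  by rewrite -!mulrA [p * _]mulrA -apX -mulrA pt !mulr0.
have vay m : v * a ^+ m * y = 0.
  rewrite !mulr_suml big1 // => i _.
  rewrite -[_ * p * _ * _]mulrA -exprD exprSr -!mulrA.
  by rewrite (mulrA t) (mulrA (t * y)) (mulrA (t * y * p)) typay mulr0.
have vy : v * y = 0 by have := vay 0; rewrite expr0 mulr1.
(* Telescoping: left multiplication by t and right multiplication by a shift
   the sum v by one; the new top term has the factor p a^k = 0. *)
have va : t * y * p + t * v * a = v.
  have -> : t * v * a = \sum_(i < k) t ^+ i.+2 * y * p * a ^+ i.+1.
    rewrite mulr_sumr mulr_suml; apply: eq_bigr => i _.
    by rewrite (exprS t i.+1) (exprSr a i) !mulrA.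
  transitivity (\sum_(i < k.+1) t ^+ i.+1 * y * p * a ^+ i).
    by rewrite big_ord_recl /= expr1 mulr1.
  by rewrite big_ord_recr /= -(mulrA _ p) pak mulr0 addr0.
have vak : v * a ^+ k = 0.
  rewrite mulr_suml big1 // => i _.
  by rewrite -mulrA -exprD addnC exprD -!mulrA (mulrA p) pak mul0r !mulr0.
have sg : s * g = s by rewrite mulrBr mulr1 !mulrA spy mul0r subr0.
have st : s * t = g * e.
  have -> : s * t = e * s * t + p * s * t by rewrite -!mulrDl subrK mul1r.
  rewrite est (mulrBl e) mul1r -(mulrA _ t) te; congr (_ + _).
  by rewrite zs mulrBl -ap -mulrA pt mulr0 sub0r.
have ts : t * s = e - t * y * p.
  have -> : t * s = t * s * e + t * s * p by rewrite -!mulrDr subrK mulr1.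
  rewrite tse; congr (_ + _).
  by rewrite zs mulrBl -mulrA ap mulrA tp mul0r sub0r.
pose q := t * (1 - v); pose u := e - v.
have qs : q * s = u.
  have vs : v * s = v * a by rewrite zs vy subr0.
  by rewrite -mulrA (mulrBl s) mul1r vs mulrBr ts mulrA -addrA -opprD va.
have squ : s * q = g * u by rewrite mulrA st -mulrA mulrBr mulr1 ev.
have -> : - (\sum_(i < k) (1 - p * y * t) * t ^+ i.+2 * y * p * a ^+ i)
     + t - p * y * t ^+ 2 = g * q.
  rewrite /q mulrBr mulr1 mulrBr -addrA addrC; congr (_ - _).
    by rewrite mulrBl mul1r expr2 mulrA.
  rewrite mulrA mulr_sumr; apply: eq_bigr => i _.
  by rewrite (exprS t i.+1) !mulrA.
have sx : s * (g * q) = g * u by rewrite mulrA sg.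
have xs : g * q * s = g * u by rewrite -mulrA qs.
have oneBu : 1 - u = p + v.
  by rewrite /u /e !opprB addrCA (addrC 1) subrK addrC.
(* The error term 1 - u lets powers of s be replaced by powers of a, because
   s p a^m y = 0 and v a^m y = 0. *)
have sup m : s * (1 - u) * s ^+ m = s * (1 - u) * a ^+ m.
  rewrite oneBu.
  elim: m => [//|m IHm].
  rewrite exprSr mulrA IHm zs exprSr mulrA.
  rewrite -[RHS]subr0; congr (_ - _).
  by rewrite mulrDr !mulrDl -!mulrA (mulrA v) vay mulr0 addr0 !mulrA zpay.
have suk : s * (1 - u) * s ^+ k = 0.
  rewrite sup -mulrA oneBu.
  by rewrite mulrDl pak vak addr0 mulr0.
have suE : s * (1 - u) = s - s * (g * u) by rewrite mulrBr mulr1 mulrA sg.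
have sus : s ^+ k * (s * (1 - u)) = 0.
  rewrite -suk; apply/esym/commrX.
  have cgu : s * (g * u) = g * u * s by rewrite -{1}xs -sx !mulrA.
  by rewrite suE /GRing.comm mulrBr mulrBl -(mulrA s) -cgu.
exists k.+1; split; last by rewrite sx xs.
  rewrite -mulrA xs exprSr -mulrA; apply/esym/subr0_eq.
  by rewrite -mulrBr -suE.
have uq : u * q = q by rewrite mulrBl (mulrA v) vt mul0r subr0 mulrA et.
have ug : u * g = u by rewrite -qs -mulrA sg.
by rewrite xs -mulrA (mulrA u) ug uq.
Qed.

Lemma converse_expr (R : pzRingType) (x : R) n : (x : R^c) ^+ n = x ^+ n :> R.
Proof. by elim: n => // n IHn; rewrite exprS exprSr -IHn. Qed.

Lemma converse_drazin_inverse (R : pzRingType) (s x : R) :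
  @drazin_inverse R^c s x -> drazin_inverse s x.
Proof.
move=> [l [sxs xsx sx]]; exists l.
move: sxs; rewrite converse_expr => sxs.
have {}sxs : s * (x * s ^+ l) = s ^+ l by [].
have {}xsx : x * (s * x) = x by [].
have {}sx : x * s = s * x by [].
split; rewrite -?mulrA // sx mulrA -exprSr exprS -mulrA -[RHS]sxs.
by congr (_ * _); apply/esym/commrX.
Qed.

(** The mirror image of [corner_drazin_inverse], obtained by applying it in the
converse ring. *)
Lemma corner_drazin_inverse_dual (R : pzRingType) (a y p t : R) (k : nat) :
  let s := a - y in
  p * p = p -> a * p = p * a -> p * a ^+ k = 0 ->
  p * t = 0 -> t * p = 0 ->
  (1 - p) * s * t = 1 - p -> t * s * (1 - p) = 1 - p ->
  y * p * s = 0 ->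
  drazin_inverse s
    (- (\sum_(i < k) a ^+ i * p * y * t ^+ i.+2 * (1 - t * y * p))
     + t - t ^+ 2 * y * p).
Proof.
move=> s pp ap pak pt tp est tse yps; apply: converse_drazin_inverse.
have akp : a ^+ k * p = 0.
  by rewrite -[RHS]pak; apply/esym/commrX; rewrite /GRing.comm ap.
have := @corner_drazin_inverse R^c a y p t k.
rewrite !converse_expr.
have -> : \sum_(i < k) a ^+ i * p * y * t ^+ i.+2 * (1 - t * y * p) =
    \sum_(i < k) (1 - (p : R^c) * y * t) * (t : R^c) ^+ i.+2 * y * p
       * (a : R^c) ^+ i.
  apply: eq_bigr => i _.
  (* A left-nested product in the converse ring is, by conversion, the
     right-nested product of the same factors in reverse order. *)
  transitivity (a ^+ i * (p * (y * (t ^+ i.+2 * (1 - t * (y * p)))))).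
    by rewrite !mulrA.
  by rewrite -[in LHS](converse_expr a) -[in LHS](converse_expr t).
rewrite -[t ^+ 2 * y * p]mulrA; apply=> //.
- by transitivity (t * (s * (1 - p))) => //; rewrite mulrA.
- by transitivity ((1 - p) * (s * t)) => //; rewrite mulrA.
- by transitivity (y * (p * s)) => //; rewrite mulrA.
Qed.

(** * The ring of square tensors *)

(** Only square tensors form a ring; products of rectangular ones keep the
notation [**], which on square tensors is convertible to ring multiplication. *)
HB.instance Definition _ (F : fieldType) (J : finType) :=
  GRing.Zmodule_isPzRing.Build (tensor F J J)
    (@einprodA F J J J J) (@einprod1l F J J) (@einprod1r F J J)
    (@einprodDl F J J J) (@einprodDr F J J J).

Section Tensor.
Variable F : fieldType.
Implicit Types J K L : finType.

Lemma tpowE J (P : tensor F J J) l : P ^^ l = P ^+ l.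
Proof. by elim: l => // l IHl; rewrite exprS -IHl. Qed.

Lemma einprodBl J K L (P Q : tensor F J K) (R : tensor F K L) :
  (P - Q) ** R = P ** R - Q ** R.
Proof. by apply/eqP; rewrite eq_sym subr_eq -einprodDl subrK. Qed.

Lemma einprodBr J K L (P : tensor F J K) (Q R : tensor F K L) :
  P ** (Q - R) = P ** Q - P ** R.
Proof. by apply/eqP; rewrite eq_sym subr_eq -einprodDr subrK. Qed.

Lemma drazin_inverseE J (P X : tensor F J J) :
  drazin_inverse P X -> drazin P = X.
Proof.
move=> [l [PXP XPX PX]]; apply: (drazin_unique (drazinP P)).
exists (ind P + l)%N; split; rewrite ?leq_addr // tpowE.
by rewrite exprD -[RHS](congr1 _ PXP) !mulrA.
Qed.

(** A right inverse is a left inverse, by finite dimension: the powers of P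
stabilise, P^l = P^(l+1) X with X commuting with P, and cancelling
P^l on the right by Q^l turns this into 1 = X P. *)
Lemma einprod_mul1C J (P Q : tensor F J J) : P * Q = 1 -> Q * P = 1.
Proof.
move=> PQ; have [l [X [PX]]] := tpow_stab P; rewrite !tpowE => Pl.
have PQl : P ^+ l * Q ^+ l = 1.
  elim: (l) => [|m IHm]; first exact: mulr1.
  by rewrite exprSr exprS -mulrA (mulrA P) PQ mul1r.
have XP : X * P = 1.
  rewrite -[LHS]mulr1 -PQl [in RHS]Pl.
  have -> : P ^+ l.+1 ** X = X * P ^+ l.+1 by apply/esym/commrX.
  by rewrite exprS !mulrA.
suff <- : X = Q by [].
by rewrite -[LHS]mulr1 -PQ mulrA XP mul1r.
Qed.

(** The index is about ranges; to compute with it, equality of ranges is turned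
into a factorisation, by choosing a preimage for each column of P^l. *)
Lemma tpow_ind_factor J (P : tensor F J J) :
  exists U : tensor F J J, P ^^ ind P = P ^^ (ind P).+1 ** U.
Proof.
rewrite /ind; case: ex_minnP => l /asboolP sr _.
have col j : exists x, [ffun i => (P ^^ l) (i, j)] = einapp (P ^^ l.+1) x.
  apply/sr; exists [ffun h => (h == j)%:R]; apply/ffunP => i.
  rewrite !ffunE (bigD1 j) //= ffunE eqxx mulr1 big1 ?addr0 // => h /negPf hj.
  by rewrite ffunE hj mulr0.
have [f fP] := fin_all_exists col.
exists [ffun q => f q.2 q.1]; apply/ffunP => -[i j].
have /ffunP/(_ i) := fP j; rewrite ffunE => ->.
rewrite ffunE [RHS]ffunE; apply: eq_bigr => h _.
by congr (_ * _); rewrite ffunE.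
Qed.

(** The defining equation P^l P^D P = P^l of [drazin] is known only for some
l that may exceed the index; iterating [tpow_ind_factor] writes P^(ind P) as a
right multiple of P^(l + ind P), which brings it down to the index. *)
Lemma drazin_proj_pow_ind J (P : tensor F J J) :
  (1 - P * drazin P) * P ^+ ind P = 0.
Proof.
have [l [_ + _ PX]] := drazinP P; have [U +] := tpow_ind_factor P.
rewrite !tpowE => PU PXP.
have {}PU : P ^+ ind P = P ^+ (ind P).+1 * U := PU.
have {}PXP : P ^+ l * drazin P * P = P ^+ l := PXP.
have {}PX : P * drazin P = drazin P * P := PX.
have PUn n : P ^+ ind P = P ^+ (n + ind P) * U ^+ n.
  elim: n => [|n IHn]; first by rewrite mulr1.
  by rewrite {1}IHn exprD {1}PU (exprS U) !mulrA -exprD addnS.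
have PPl : P * drazin P * P ^+ l = P ^+ l.
  rewrite -[RHS]PXP PX -!mulrA -exprS exprSr !mulrA; congr (_ * _).
  exact: commrX.
by rewrite (PUn l) exprD !mulrA mulrBl mul1r PPl subrr !mul0r.
Qed.

(** * The generalized Schur complement *)

(** Substituting B A' C = D - Z in the expansion of the left-hand side gives
E := A A' plus the difference of the two sides of the hypothesis multiplied by
A on the left. *)
Lemma schur_corner_right_inverse J L
  (A A' : tensor F J J) (B : tensor F L J) (C : tensor F J L)
  (D D' Z' : tensor F L L) :
  let Z := D - B ** A' ** C in
  A' ** A ** A' = A' -> A ** A' = A' ** A -> D ** D' = D' ** D ->
  A' ** C ** (tunit L - D ** D') ** Z' ** (B ** A')
    = A' ** C ** D' ** (tunit L - Z ** Z') ** (B ** A') ->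
  A ** A' ** (A - C ** D' ** B) ** (A' + A' ** C ** Z' ** (B ** A')) = A ** A'.
Proof.
move=> Z AXA AX DX hyp.
have BAC : B ** (A' ** C) = D - Z by rewrite einprodA /Z opprB addrC subrK.
clearbody Z; set E := A ** A'.
have EAX : E ** A ** A' = E by rewrite /E -!einprodA (einprodA A') AXA.
have ECDBAC : E ** C ** D' ** B ** A' ** C
    = E ** C ** D ** D' - E ** C ** D' ** Z.
  by rewrite -!einprodA BAC !einprodBr DX.
have := congr1 (einprod A) hyp.
rewrite !einprodBr !einprodBl !einprod1r !einprodBr !einprodA -/E.
move/eqP; rewrite subr_eq -addrA [- _ + _]addrC => /eqP hypE.
by rewrite !einprodDr !einprodA EAX ECDBAC !einprodBl hypE addrK.
Qed.

End Tensor.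

Unset Implicit Arguments.

Theorem theorem3p8 (R : realType) (N M : nat)
  (dI : 'I_N -> nat) (dH : 'I_M -> nat)
  (N_gt0 : (0 < N)%N) (M_gt0 : (0 < M)%N)
  (dI_gt0 : forall k, (0 < dI k)%N) (dH_gt0 : forall k, (0 < dH k)%N)
  (A : tensor R[i] (midx dI) (midx dI)) (B : tensor R[i] (midx dH) (midx dI))
  (C : tensor R[i] (midx dI) (midx dH)) (D : tensor R[i] (midx dH) (midx dH)) :
  let Api := tunit (midx dI) - A ** drazin A in
  let Y := C ** drazin D ** B in
  let S := A - C ** drazin D ** B in
  let Z := D - B ** drazin A ** C in
  let Dpi := tunit (midx dH) - D ** drazin D in
  let Zpi := tunit (midx dH) - Z ** drazin Z in
  let H := B ** drazin A in
  let K := drazin A ** C in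
  let T := drazin A + K ** drazin Z ** H in
  let k := ind A in
  K ** Dpi ** drazin Z ** H = K ** drazin D ** Zpi ** H ->
  (S ** Api ** Y = 0 ->
   drazin S =
     - (\sum_(i < k)
          (tunit (midx dI) - Api ** Y ** T) ** T ^^ i.+2 ** Y ** Api ** A ^^ i)
     + T - Api ** Y ** T ^^ 2) /\
  (Y ** Api ** S = 0 ->
   drazin S =
     - (\sum_(i < k)
          A ^^ i ** Api ** Y ** T ^^ i.+2 ** (tunit (midx dI) - T ** Y ** Api))
     + T - T ^^ 2 ** Y ** Api).
Proof.
move=> Api Y S Z Dpi Zpi H K T k hyp.
pose E := A * drazin A.
have [l [_ _ AXA AX]] := drazinP A.
have [m [_ _ _ DX]] := drazinP D.
have EST : E * S * T = E := schur_corner_right_inverse AXA AX DX hyp.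
have {}AXA : drazin A * A * drazin A = drazin A := AXA.
have {}AX : A * drazin A = drazin A * A := AX.
have EX : E * drazin A = drazin A by rewrite /E AX.
have XE : drazin A * E = drazin A by rewrite /E mulrA.
have EE : E * E = E by rewrite {1}/E -mulrA XE.
have AE : A * E = E * A by rewrite /E -[RHS]mulrA -AX.
have pAk : Api * A ^+ k = 0 by apply: drazin_proj_pow_ind.
have ApiE : Api = 1 - E by [].
have ET : E ** T = T.
  have {}EX : E ** drazin A = drazin A := EX.
  by rewrite /T /K /H einprodDr !einprodA EX.
have TE : T ** E = T.
  have {}XE : drazin A ** E = drazin A := XE.
  by rewrite /T /K /H einprodDl -!einprodA XE.
have {}ET : E * T = T := ET.
have {}TE : T * E = T := TE.
clearbody Api E T.
have p1 : Api * T = 0 by rewrite ApiE mulrBl mul1r ET subrr.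
have p2 : T * Api = 0 by rewrite ApiE mulrBr mulr1 TE subrr.
have EpE : E * Api = 0 by rewrite ApiE mulrBr mulr1 EE subrr.
have pEE : Api * E = 0 by rewrite ApiE mulrBl mul1r EE subrr.
have pp : Api * Api = Api by rewrite {1}ApiE mulrBl mul1r EpE subr0.
have Ap : A * Api = Api * A by rewrite ApiE mulrBl mulrBr mul1r mulr1 AE.
have Epi : 1 - Api = E by rewrite ApiE opprB addrC subrK.
(* One-sided invertibility passes from the corner to the whole ring by adding
   the idempotent Api to both factors. *)
have TSE : T * S * E = E.
  have : (E * S * E + Api) * (T + Api) = 1.
    rewrite mulrDr !mulrDl p1 pp addr0 -(mulrA _ E T) ET EST -mulrA EpE mulr0.
    by rewrite add0r -Epi subrK.
  move/einprod_mul1C; rewrite mulrDr !mulrDl p2 pp !mulrA TE pEE !mul0r.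
  by rewrite addr0 add0r -[1](subrK Api) Epi => /addIr.
split=> SpY.
  have := @corner_drazin_inverse _ A Y Api T k pp Ap pAk p1 p2.
  rewrite Epi => /(_ EST TSE SpY)/drazin_inverseE ->.
  by rewrite -tpowE; under eq_bigr => i _ do rewrite -!tpowE.
have := @corner_drazin_inverse_dual _ A Y Api T k pp Ap pAk p1 p2.
rewrite Epi => /(_ EST TSE SpY)/drazin_inverseE ->.
by rewrite -tpowE; under eq_bigr => i _ do rewrite -!tpowE.
Qed.
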